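(* Let $s\ge 1$, let $a_{ij},b_i\in\mathbb{R}$ ($i,j=1,\dots,s$) be Runge--Kutta coefficients with $c_i=\sum_{j=1}^s a_{ij}$, and suppose that $$b_ia_{ij}+b_ja_{ji}=b_ib_j\qquad\text{for all } i,j=1,\dots,s.$$ Let $u^0,u^1,u^2,\dots$ be produced by the following linear scheme (Scheme 2.1) with time step $\tau>0$: for each $n\ge 0$, given $u^n$ and the extrapolated values $u_i^{n,*}=\mathcal{L}_{MP}(\mathbf{x},t_n+c_i\tau)$, $i=1,\dots,s$, the stages $u_i^n$, $k_i^n$ and the new value $u^{n+1}$ satisfy $$k_i^n=\mathcal{D}^{-1}\mathcal{G}(u_i^{n,*})u_i^n,\qquad u_i^n=u^n+\tau\sum_{j=1}^s a_{ij}k_j^n,\qquad i=1,\dots,s,$$ $$u^{n+1}=u^n+\tau\sum_{i=1}^s b_ik_i^n .$$ Then the scheme exactly preserves the semi-discrete momentum: $$I^{n+1}=I^n,\qquad I^n:=\tfrac12\,(u^n,\mathcal{D}u^n),\qquad n=0,1,2,\dots$$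
   Context: Setting: the regularized long-wave equation $\partial_tu+\alpha\partial_xu+\beta\partial_yu+\alpha u\partial_xu+\beta u\partial_yu-\mu\partial_{xxt}u-\theta\partial_{yyt}u=0$ on $\Omega=[a,b]\times[c,d]$ with periodic boundary conditions, where $\alpha,\beta\in\mathbb{R}$, $\mu>0$, $\theta>0$ are constants. All functions of $\mathbf{x}=(x,y)$ are real-valued, periodic on $\Omega$ and smooth; the scheme is discrete in time only. $(u,v)=\int_\Omega uv\,d\mathbf{x}$. $\mathcal{D}=1-\mu\partial_{xx}-\theta\partial_{yy}$, which is self-adjoint and invertible on periodic functions. For a function $w$, $\mathcal{G}(w)$ is the linear operator $$\mathcal{G}(w)v=-\Big[\alpha\partial_xv+\beta\partial_yv+\tfrac{\alpha}{3}\big(w\,\partial_xv+\partial_x(wv)\big)+\tfrac{\beta}{3}\big(w\,\partial_yv+\partial_y(wv)\big)\Big].$$ The equation is equivalent to $\mathcal{D}u_t=\mathcal{G}(u)u$. Time grid: $t_n=n\tau$, $t_{ni}=t_n+c_i\tau$, with $c_1,\dots,c_s$ distinct real numbers; $u^n$ and $u_i^n$ approximate $u$ at $t_n$ and $t_{ni}$. At step $n$, $\mathcal{L}_{MP}(\mathbf{x},t)$ is the Lagrange interpolating polynomial in $t$ (with coefficients functions of $\mathbf{x}$) through numerical values of $u$ already computed at finitely many distinct time nodes $\le t_n$ (values $u^m$ at grid points and/or earlier stage values). In particular each $u_i^{n,*}$ is a known function of $\mathbf{x}$, independent of the unknowns of step $n$. *)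

(* Defs.v *)
From Stdlib Require Import Reals List.
From Coquelicot Require Import Coquelicot.
Open Scope R_scope.

(** Functions on the periodic box [[xl,xr] x [yl,yr]] are represented by their
    periodic extension to the whole plane. *)

Definition field := R -> R -> R.

Definition dx (f : field) : field := fun x y => Derive (fun z => f z y) x.
Definition dy (f : field) : field := fun x y => Derive (fun z => f x z) y.

(** [ex_diff_n f n x y]: all iterated partial derivatives of [f] of order at
    most [n], in any order of differentiation, exist at [(x, y)] and are
    jointly continuous there. *)
Definition smooth (f : field) : Prop := forall n x y, ex_diff_n f n x y.

Definition periodic (xl xr yl yr : R) (f : field) : Prop :=
  forall x y, f (x + (xr - xl)) y = f x y /\ f x (y + (yr - yl)) = f x y.

Definition smooth_periodic (xl xr yl yr : R) (f : field) : Prop :=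
  smooth f /\ periodic xl xr yl yr f.

(** The integral over the box is taken as an iterated Riemann integral; it is
    only applied to continuous functions. *)
Definition inner (xl xr yl yr : R) (f g : field) : R :=
  RInt (fun x => RInt (fun y => f x y * g x y) yl yr) xl xr.

Definition opD (mu theta : R) (f : field) : field :=
  fun x y => f x y - mu * dx (dx f) x y - theta * dy (dy f) x y.

(** [is_opDinv ... f k] is the relation [k = D^-1 f], where [D] is regarded as
    an operator on smooth periodic functions (on which it is bijective for
    [mu, theta > 0]). *)
Definition is_opDinv (xl xr yl yr mu theta : R) (f k : field) : Prop :=
  smooth_periodic xl xr yl yr k /\ forall x y, opD mu theta k x y = f x y.

Definition opG (alpha beta : R) (w v : field) : field :=
  fun x y =>
    - (alpha * dx v x y + beta * dy v x y
       + alpha / 3 * (w x y * dx v x y + dx (fun x' y' => w x' y' * v x' y') x y)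
       + beta / 3 * (w x y * dy v x y + dy (fun x' y' => w x' y' * v x' y') x y)).

Definition momentum (xl xr yl yr mu theta : R) (f : field) : R :=
  / 2 * inner xl xr yl yr f (opD mu theta f).

(** Indices [1, ..., s], as in Butcher tableaux. *)
Definition stage_index (s i : nat) : Prop := (1 <= i <= s)%nat.
Definition stage_sum (s : nat) (f : nat -> R) : R := sum_n_m f 1 s.

(** [lagrange_basis ts p] is the polynomial in [t] equal to 1 at the node [p]
    and to 0 at the other nodes of the duplicate-free list [ts]. *)
Definition lagrange_basis (ts : list R) (p t : R) : R :=
  fold_right Rmult 1 (map (fun q => (t - q) / (p - q)) (remove Req_EM_T p ts)).

Definition lagrange (data : list (R * field)) (t : R) : field :=
  fun x y =>
    fold_right Rplus 0
      (map (fun d => snd d x y * lagrange_basis (map fst data) (fst d) t) data).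

(** Interpolation nodes: [Grid m] carries the value [u^m] at time [t_m], and
    [Stage m i] the stage value [u_i^m] at time [t_m + c_i tau]. *)
Inductive node := Grid (m : nat) | Stage (m i : nat).

Definition node_time (tau : R) (c : nat -> R) (p : node) : R :=
  match p with
  | Grid m => INR m * tau
  | Stage m i => INR m * tau + c i * tau
  end.

Definition node_value (u : nat -> field) (U : nat -> nat -> field) (p : node) : field :=
  match p with
  | Grid m => u m
  | Stage m i => U m i
  end.

(** Values already available at the beginning of step [n]. *)
Definition computed (s n : nat) (p : node) : Prop :=
  match p with
  | Grid m => (m <= n)%nat
  | Stage m i => (m < n)%nat /\ stage_index s i
  end.

Definition admissible_nodes (s : nat) (tau : R) (c : nat -> R) (n : nat)
    (l : list node) : Prop :=
  l <> nil /\
  NoDup (map (node_time tau c) l) /\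
  forall p, In p l -> computed s n p /\ node_time tau c p <= INR n * tau.

(** The polynomial [L_MP] built on the nodes [l], evaluated at time [t]. *)
Definition L_MP (tau : R) (c : nat -> R) (u : nat -> field)
    (U : nat -> nat -> field) (l : list node) (t : R) : field :=
  lagrange (map (fun p => (node_time tau c p, node_value u U p)) l) t.

(** [scheme ... nodes u U k]: the [u n], with stages [U n i] and slopes [k n i],
    are produced by the linear scheme, the extrapolation at step [n] using the
    nodes [nodes n]. *)
Record scheme (xl xr yl yr alpha beta mu theta tau : R)
    (s : nat) (a : nat -> nat -> R) (b c : nat -> R)
    (nodes : nat -> list node)
    (u : nat -> field) (U k : nat -> nat -> field) : Prop := {
  scheme_u_smooth : forall n, smooth_periodic xl xr yl yr (u n);
  scheme_U_smooth : forall n i, stage_index s i ->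
    smooth_periodic xl xr yl yr (U n i);
  scheme_nodes : forall n, admissible_nodes s tau c n (nodes n);
  scheme_slope : forall n i, stage_index s i ->
    is_opDinv xl xr yl yr mu theta
      (opG alpha beta (L_MP tau c u U (nodes n) (INR n * tau + c i * tau)) (U n i))
      (k n i);
  scheme_stage : forall n i, stage_index s i -> forall x y,
    U n i x y = u n x y + tau * stage_sum s (fun j => a i j * k n j x y);
  scheme_step : forall n x y,
    u (S n) x y = u n x y + tau * stage_sum s (fun i => b i * k n i x y)
}.

(* Main.v *)
Require Import Defs.
From Stdlib Require Import Reals List Lra Lia.
From Coquelicot Require Import Coquelicot.
Open Scope R_scope.

(** Write [B(f, g) = (f, D g)].  Three facts carry the proof.

    - [B] is symmetric on smooth periodic functions ([inner_opD_sym]):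
      [f D g - g D f] is the divergence of a periodic field, and such a
      divergence integrates to zero over the box ([box_dx], [box_dy]).
    - [(v, G(w) v) = 0] for every periodic C^1 function [w]
      ([inner_opG_diag]): the two halves of each split nonlinear term add up
      to the exact derivative of [w v^2].  The extrapolation [w_i], a Lagrange
      polynomial in time with smooth periodic coefficients, is such a function
      ([C1_periodic_lagrange]), so every stage satisfies
      [B(U_i, k_i) = (U_i, G(w_i) U_i) = 0].
    - Writing [m_ij = B(k_i, k_j)], the stage equations turn this into
      [B(u^n, k_i) = - tau sum_j a_ij m_ji].  Then
      [B(u^(n+1), u^(n+1)) - B(u^n, u^n)
         = 2 tau sum_i b_i B(u^n, k_i) + tau^2 sum_ij b_i b_j m_ij
         = tau^2 sum_ij (b_i b_j - b_i a_ij - b_j a_ji) m_ij],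
      which vanishes by the condition on the coefficients
      ([symplectic_cancellation]). *)

(** * Continuous and continuously differentiable periodic fields *)

Definition continuous_field (f : field) : Prop :=
  forall x y, continuity_2d_pt f x y.

(** First-order regularity is all that the integrations by parts use; unlike
    [smooth], it is stable under products by a one-line Leibniz rule. *)
Record C1_periodic (xl xr yl yr : R) (f : field) : Prop := {
  C1_ex_dx : forall x y, ex_derive (fun z => f z y) x;
  C1_ex_dy : forall x y, ex_derive (fun z => f x z) y;
  C1_cont : continuous_field f;
  C1_cont_dx : continuous_field (dx f);
  C1_cont_dy : continuous_field (dy f);
  C1_per : periodic xl xr yl yr f
}.

Arguments C1_ex_dx {xl xr yl yr f} _ x y.
Arguments C1_ex_dy {xl xr yl yr f} _ x y.
Arguments C1_cont {xl xr yl yr f} _ x y.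
Arguments C1_cont_dx {xl xr yl yr f} _ x y.
Arguments C1_cont_dy {xl xr yl yr f} _ x y.
Arguments C1_per {xl xr yl yr f} _ x y.

Lemma dx_const (k x y : R) : dx (fun _ _ => k) x y = 0.
Proof. exact (Derive_const k x). Qed.

Lemma dy_const (k x y : R) : dy (fun _ _ => k) x y = 0.
Proof. exact (Derive_const k y). Qed.

Lemma C1_periodic_const xl xr yl yr (k : R) :
  C1_periodic xl xr yl yr (fun _ _ => k).
Proof.
  split; try (intros x y; apply ex_derive_const).
  - intros x y; apply continuity_2d_pt_const.
  - intros x y; apply continuity_2d_pt_ext with (fun _ _ => 0).
    + intros; now rewrite dx_const.
    + apply continuity_2d_pt_const.
  - intros x y; apply continuity_2d_pt_ext with (fun _ _ => 0).
    + intros; now rewrite dy_const.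
    + apply continuity_2d_pt_const.
  - now split.
Qed.

Lemma dx_plus xl xr yl yr f g x y :
  C1_periodic xl xr yl yr f -> C1_periodic xl xr yl yr g ->
  dx (fun x y => f x y + g x y) x y = dx f x y + dx g x y.
Proof.
  intros Cf Cg.
  apply (Derive_plus (fun z => f z y) (fun z => g z y));
    [apply (C1_ex_dx Cf) | apply (C1_ex_dx Cg)].
Qed.

Lemma dy_plus xl xr yl yr f g x y :
  C1_periodic xl xr yl yr f -> C1_periodic xl xr yl yr g ->
  dy (fun x y => f x y + g x y) x y = dy f x y + dy g x y.
Proof.
  intros Cf Cg.
  apply (Derive_plus (fun z => f x z) (fun z => g x z));
    [apply (C1_ex_dy Cf) | apply (C1_ex_dy Cg)].
Qed.

Lemma dx_mult xl xr yl yr f g x y :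
  C1_periodic xl xr yl yr f -> C1_periodic xl xr yl yr g ->
  dx (fun x y => f x y * g x y) x y = dx f x y * g x y + f x y * dx g x y.
Proof.
  intros Cf Cg.
  apply (Derive_mult (fun z => f z y) (fun z => g z y));
    [apply (C1_ex_dx Cf) | apply (C1_ex_dx Cg)].
Qed.

Lemma dy_mult xl xr yl yr f g x y :
  C1_periodic xl xr yl yr f -> C1_periodic xl xr yl yr g ->
  dy (fun x y => f x y * g x y) x y = dy f x y * g x y + f x y * dy g x y.
Proof.
  intros Cf Cg.
  apply (Derive_mult (fun z => f x z) (fun z => g x z));
    [apply (C1_ex_dy Cf) | apply (C1_ex_dy Cg)].
Qed.

Lemma C1_periodic_plus xl xr yl yr f g :
  C1_periodic xl xr yl yr f -> C1_periodic xl xr yl yr g ->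
  C1_periodic xl xr yl yr (fun x y => f x y + g x y).
Proof.
  intros Cf Cg; split; intros x y.
  - apply (ex_derive_plus (V := R_NormedModule) (fun z => f z y) (fun z => g z y));
      [apply (C1_ex_dx Cf) | apply (C1_ex_dx Cg)].
  - apply (ex_derive_plus (V := R_NormedModule) (fun z => f x z) (fun z => g x z));
      [apply (C1_ex_dy Cf) | apply (C1_ex_dy Cg)].
  - apply continuity_2d_pt_plus; [apply (C1_cont Cf) | apply (C1_cont Cg)].
  - apply continuity_2d_pt_ext with (fun x y => dx f x y + dx g x y).
    + intros; symmetry; eapply dx_plus; eassumption.
    + apply continuity_2d_pt_plus;
        [apply (C1_cont_dx Cf) | apply (C1_cont_dx Cg)].
  - apply continuity_2d_pt_ext with (fun x y => dy f x y + dy g x y).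
    + intros; symmetry; eapply dy_plus; eassumption.
    + apply continuity_2d_pt_plus;
        [apply (C1_cont_dy Cf) | apply (C1_cont_dy Cg)].
  - destruct (C1_per Cf x y) as [-> ->], (C1_per Cg x y) as [-> ->]; now split.
Qed.

Lemma C1_periodic_mult xl xr yl yr f g :
  C1_periodic xl xr yl yr f -> C1_periodic xl xr yl yr g ->
  C1_periodic xl xr yl yr (fun x y => f x y * g x y).
Proof.
  intros Cf Cg; split; intros x y.
  - apply (ex_derive_mult (fun z => f z y) (fun z => g z y));
      [apply (C1_ex_dx Cf) | apply (C1_ex_dx Cg)].
  - apply (ex_derive_mult (fun z => f x z) (fun z => g x z));
      [apply (C1_ex_dy Cf) | apply (C1_ex_dy Cg)].
  - apply continuity_2d_pt_mult; [apply (C1_cont Cf) | apply (C1_cont Cg)].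
  - apply continuity_2d_pt_ext
      with (fun x y => dx f x y * g x y + f x y * dx g x y).
    + intros; symmetry; eapply dx_mult; eassumption.
    + apply continuity_2d_pt_plus; apply continuity_2d_pt_mult;
        first [apply (C1_cont Cf) | apply (C1_cont Cg)
              | apply (C1_cont_dx Cf) | apply (C1_cont_dx Cg)].
  - apply continuity_2d_pt_ext
      with (fun x y => dy f x y * g x y + f x y * dy g x y).
    + intros; symmetry; eapply dy_mult; eassumption.
    + apply continuity_2d_pt_plus; apply continuity_2d_pt_mult;
        first [apply (C1_cont Cf) | apply (C1_cont Cg)
              | apply (C1_cont_dy Cf) | apply (C1_cont_dy Cg)].
  - destruct (C1_per Cf x y) as [-> ->], (C1_per Cg x y) as [-> ->]; now split.
Qed.

Lemma smooth_periodic_C1 xl xr yl yr f :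
  smooth_periodic xl xr yl yr f -> C1_periodic xl xr yl yr f.
Proof.
  intros [Sf Pf]; split; trivial; intros x y;
    destruct (Sf 1%nat x y) as (? & ? & ? & (? & _) & (? & _)); assumption.
Qed.

Lemma Derive_periodic (f : R -> R) (p : R) :
  (forall x, ex_derive f x) -> (forall x, f (x + p) = f x) ->
  forall x, Derive f (x + p) = Derive f x.
Proof.
  intros Ef Pf x.
  rewrite <- (Derive_ext (fun z => f (z + p)) f x Pf).
  apply eq_sym, is_derive_unique.
  auto_derive; [apply Ef | now rewrite Rmult_1_l].
Qed.

Lemma smooth_periodic_dx xl xr yl yr f :
  smooth_periodic xl xr yl yr f -> smooth_periodic xl xr yl yr (dx f).
Proof.
  intros Sf; pose proof (smooth_periodic_C1 _ _ _ _ _ Sf) as Cf; split.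
  - intros n x y; now destruct (proj1 Sf (S n) x y) as (_ & _ & _ & ? & _).
  - intros x y; split.
    + apply (Derive_periodic (fun z => f z y)); intros z;
        [apply (C1_ex_dx Cf) | apply (C1_per Cf)].
    + apply Derive_ext; intros z; apply (C1_per Cf).
Qed.

Lemma smooth_periodic_dy xl xr yl yr f :
  smooth_periodic xl xr yl yr f -> smooth_periodic xl xr yl yr (dy f).
Proof.
  intros Sf; pose proof (smooth_periodic_C1 _ _ _ _ _ Sf) as Cf; split.
  - intros n x y; now destruct (proj1 Sf (S n) x y) as (_ & _ & _ & _ & ?).
  - intros x y; split.
    + apply Derive_ext; intros z; apply (C1_per Cf).
    + apply (Derive_periodic (fun z => f x z)); intros z;
        [apply (C1_ex_dy Cf) | apply (C1_per Cf)].
Qed.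

Lemma continuous_opD xl xr yl yr mu theta f :
  smooth_periodic xl xr yl yr f -> continuous_field (opD mu theta f).
Proof.
  intros Sf x y.
  repeat apply continuity_2d_pt_minus.
  - apply (C1_cont (smooth_periodic_C1 _ _ _ _ _ Sf)).
  - apply continuity_2d_pt_mult; [apply continuity_2d_pt_const |].
    apply (C1_cont_dx (smooth_periodic_C1 _ _ _ _ _ (smooth_periodic_dx _ _ _ _ _ Sf))).
  - apply continuity_2d_pt_mult; [apply continuity_2d_pt_const |].
    apply (C1_cont_dy (smooth_periodic_C1 _ _ _ _ _ (smooth_periodic_dy _ _ _ _ _ Sf))).
Qed.

(** * Integration over the box *)

Definition box (xl xr yl yr : R) (f : field) : R :=
  RInt (fun x => RInt (fun y => f x y) yl yr) xl xr.

Lemma continuous_slice_y f x y :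
  continuous_field f -> continuous (fun z => f x z) y.
Proof.
  intros Cf; apply continuity_pt_filterlim, continuity_pt_locally.
  intros eps; destruct (Cf x y eps) as [d Hd].
  exists d; intros z Hz; apply Hd; [| exact Hz].
  rewrite Rminus_diag, Rabs_R0; apply cond_pos.
Qed.

Lemma ex_RInt_slice_y yl yr f x :
  continuous_field f -> ex_RInt (fun y => f x y) yl yr.
Proof.
  intros Cf; apply (ex_RInt_continuous (V := R_CompleteNormedModule)).
  intros y _; now apply continuous_slice_y.
Qed.

(** By compactness of [[yl,yr]], [f] is continuous in [x] uniformly in [y]. *)
Lemma continuous_RInt_slice yl yr f :
  yl < yr -> continuous_field f ->
  forall x, continuous (fun z => RInt (fun y => f z y) yl yr) x.
Proof.
  intros Hy Cf x; apply continuity_pt_filterlim, continuity_pt_locally.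
  intros eps.
  (* The bound on the integrand leaves a factor 2 to make the final estimate
     strict. *)
  assert (He : 0 < eps / (2 * (yr - yl))).
  { apply Rdiv_lt_0_compat; [apply cond_pos | lra]. }
  destruct (uniform_continuity_2d_1d' f yl yr x (fun y _ => Cf x y)
              (mkposreal _ He)) as [d Hd].
  exists d; intros z Hz.
  rewrite <- (RInt_minus (fun y => f z y) (fun y => f x y));
    try now apply ex_RInt_slice_y.
  assert (Hzx : Rabs (z - x) < d) by exact Hz.
  apply Rle_lt_trans with ((yr - yl) * (eps / (2 * (yr - yl)))).
  - apply abs_RInt_le_const; [lra | |].
    + apply (ex_RInt_minus (fun y => f z y) (fun y => f x y));
        now apply ex_RInt_slice_y.
    + intros y Hyy; apply Rlt_le.
      apply (Hd y x y z); try assumption.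
      * split; pose proof (cond_pos d); lra.
      * apply Rabs_lt_between' in Hzx; lra.
      * rewrite Rminus_diag, Rabs_R0; apply cond_pos.
  - replace ((yr - yl) * (eps / (2 * (yr - yl)))) with (eps / 2) by (field; lra).
    pose proof (cond_pos eps); lra.
Qed.

Lemma box_ext xl xr yl yr f g :
  (forall x y, f x y = g x y) -> box xl xr yl yr f = box xl xr yl yr g.
Proof.
  intros H; apply RInt_ext; intros x _; apply RInt_ext; intros y _; apply H.
Qed.

Lemma box_lin xl xr yl yr f g (k : R) :
  yl < yr -> continuous_field f -> continuous_field g ->
  box xl xr yl yr (fun x y => f x y + k * g x y)
  = box xl xr yl yr f + k * box xl xr yl yr g.
Proof.
  intros Hy Cf Cg; unfold box.
  assert (E : forall h, continuous_field h ->
            ex_RInt (fun x => RInt (fun y => h x y) yl yr) xl xr).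
  { intros h Ch; apply (ex_RInt_continuous (V := R_CompleteNormedModule)).
    intros x _; now apply continuous_RInt_slice. }
  rewrite <- (RInt_scal (V := R_CompleteNormedModule)
                (fun x => RInt (fun y => g x y) yl yr)) by now apply E.
  rewrite <- (RInt_plus (V := R_CompleteNormedModule)
                (fun x => RInt (fun y => f x y) yl yr)
                (fun x => scal k (RInt (fun y => g x y) yl yr)));
    [| now apply E
     | apply (ex_RInt_scal (fun x => RInt (fun y => g x y) yl yr)); now apply E].
  apply RInt_ext; intros x _.
  rewrite <- (RInt_scal (V := R_CompleteNormedModule) (fun y => g x y))
    by now apply ex_RInt_slice_y.
  rewrite <- (RInt_plus (V := R_CompleteNormedModule) (fun y => f x y)
                (fun y => scal k (g x y)));
    [reflexivity | now apply ex_RInt_slice_y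
     | apply (ex_RInt_scal (fun y => g x y)); now apply ex_RInt_slice_y].
Qed.

(** Differentiating under the inner integral sign makes the outer integrand an
    exact derivative, which avoids exchanging the order of integration. *)
Lemma box_dx xl xr yl yr h :
  yl < yr -> C1_periodic xl xr yl yr h -> box xl xr yl yr (dx h) = 0.
Proof.
  intros Hy Ch; unfold box.
  set (H := fun x => RInt (fun y => h x y) yl yr).
  assert (D : forall x, is_derive H x (RInt (fun y => dx h x y) yl yr)).
  { intros x; apply (is_derive_RInt_param h).
    - apply filter_forall; intros z t _; apply (C1_ex_dx Ch).
    - intros t _; apply (C1_cont_dx Ch).
    - apply filter_forall; intros z; apply ex_RInt_slice_y, (C1_cont Ch). }
  rewrite (is_RInt_unique _ _ _ _
    (is_RInt_derive H _ xl xr (fun x _ => D x)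
       (fun x _ => continuous_RInt_slice _ _ _ Hy (C1_cont_dx Ch) x))).
  replace (H xr) with (H xl); [apply (minus_eq_zero (H xl)) |].
  apply RInt_ext; intros y _.
  rewrite <- (proj1 (C1_per Ch xl y)); f_equal; lra.
Qed.

Lemma box_dy xl xr yl yr h :
  C1_periodic xl xr yl yr h -> box xl xr yl yr (dy h) = 0.
Proof.
  intros Ch; unfold box.
  transitivity (RInt (fun _ => 0) xl xr).
  - apply RInt_ext; intros x _.
    transitivity (h x yr - h x yl).
    + apply (RInt_Derive (fun y => h x y)); intros y _;
        [apply (C1_ex_dy Ch) |].
      apply (continuous_slice_y (dy h)), (C1_cont_dy Ch).
    + replace yr with (yl + (yr - yl)) at 1 by lra.
      rewrite (proj2 (C1_per Ch x yl)); lra.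
  - rewrite RInt_const; apply Rmult_0_r.
Qed.

Lemma box_0 xl xr yl yr : box xl xr yl yr (fun _ _ => 0) = 0.
Proof.
  transitivity (box xl xr yl yr (dy (fun _ _ => 0)));
    [| apply box_dy, C1_periodic_const].
  apply box_ext; intros x y; now rewrite dy_const.
Qed.

Lemma box_add_divergence xl xr yl yr f p q (r t : R) :
  yl < yr -> continuous_field f ->
  C1_periodic xl xr yl yr p -> C1_periodic xl xr yl yr q ->
  box xl xr yl yr (fun x y => f x y + r * dx p x y + t * dy q x y)
  = box xl xr yl yr f.
Proof.
  intros Hy Cf Cp Cq.
  rewrite (box_lin _ _ _ _ (fun x y => f x y + r * dx p x y) (dy q) t Hy).
  - rewrite (box_lin _ _ _ _ f (dx p) r Hy Cf (C1_cont_dx Cp)).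
    rewrite (box_dx _ _ _ _ _ Hy Cp), (box_dy _ _ _ _ _ Cq); ring.
  - intros x y; apply continuity_2d_pt_plus; [exact (Cf x y) |].
    apply continuity_2d_pt_mult; [apply continuity_2d_pt_const | apply (C1_cont_dx Cp)].
  - apply (C1_cont_dy Cq).
Qed.

(** * The operators *)

(** The Wronskian-like flux [f g' - g f'] of Green's second identity, where
    [f'] and [g'] stand for partial derivatives of [f] and [g] in either
    direction; in that direction the first-order products cancel. *)
Lemma C1_periodic_wronskian xl xr yl yr f g f' g' :
  C1_periodic xl xr yl yr f -> C1_periodic xl xr yl yr g ->
  C1_periodic xl xr yl yr f' -> C1_periodic xl xr yl yr g' ->
  let p := fun x y => f x y * g' x y + -1 * (g x y * f' x y) in
  C1_periodic xl xr yl yr p /\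
  (forall x y, dx p x y = dx f x y * g' x y + f x y * dx g' x y
                 - dx g x y * f' x y - g x y * dx f' x y) /\
  (forall x y, dy p x y = dy f x y * g' x y + f x y * dy g' x y
                 - dy g x y * f' x y - g x y * dy f' x y).
Proof.
  intros Cf Cg Cf' Cg' p.
  pose proof (C1_periodic_mult _ _ _ _ _ _ Cf Cg') as C1.
  pose proof (C1_periodic_mult _ _ _ _ _ _ Cg Cf') as C2.
  pose proof (C1_periodic_const xl xr yl yr (-1)) as C0.
  pose proof (C1_periodic_mult _ _ _ _ _ _ C0 C2) as C3.
  split; [exact (C1_periodic_plus _ _ _ _ _ _ C1 C3) |].
  split; intros x y; unfold p.
  - rewrite (dx_plus _ _ _ _ _ _ _ _ C1 C3), (dx_mult _ _ _ _ _ _ _ _ Cf Cg'),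
      (dx_mult _ _ _ _ _ _ _ _ C0 C2), (dx_mult _ _ _ _ _ _ _ _ Cg Cf').
    rewrite dx_const; ring.
  - rewrite (dy_plus _ _ _ _ _ _ _ _ C1 C3), (dy_mult _ _ _ _ _ _ _ _ Cf Cg'),
      (dy_mult _ _ _ _ _ _ _ _ C0 C2), (dy_mult _ _ _ _ _ _ _ _ Cg Cf').
    rewrite dy_const; ring.
Qed.

Lemma inner_opD_sym xl xr yl yr mu theta f g :
  yl < yr ->
  smooth_periodic xl xr yl yr f -> smooth_periodic xl xr yl yr g ->
  inner xl xr yl yr f (opD mu theta g) = inner xl xr yl yr g (opD mu theta f).
Proof.
  intros Hy Sf Sg.
  pose proof (smooth_periodic_C1 _ _ _ _ _ Sf) as Cf.
  pose proof (smooth_periodic_C1 _ _ _ _ _ Sg) as Cg.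
  pose proof (smooth_periodic_C1 _ _ _ _ _ (smooth_periodic_dx _ _ _ _ _ Sf)) as Cfx.
  pose proof (smooth_periodic_C1 _ _ _ _ _ (smooth_periodic_dx _ _ _ _ _ Sg)) as Cgx.
  pose proof (smooth_periodic_C1 _ _ _ _ _ (smooth_periodic_dy _ _ _ _ _ Sf)) as Cfy.
  pose proof (smooth_periodic_C1 _ _ _ _ _ (smooth_periodic_dy _ _ _ _ _ Sg)) as Cgy.
  destruct (C1_periodic_wronskian _ _ _ _ _ _ _ _ Cf Cg Cfx Cgx) as (Cp & Ep & _).
  destruct (C1_periodic_wronskian _ _ _ _ _ _ _ _ Cf Cg Cfy Cgy) as (Cq & _ & Eq).
  symmetry.
  etransitivity; [symmetry; refine
    (box_add_divergence _ _ _ _ _ _ _ (- mu) (- theta) Hy _ Cp Cq) |].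
  - intros x y; apply continuity_2d_pt_mult; [apply (C1_cont Cg) |].
    apply (continuous_opD _ _ _ _ mu theta _ Sf).
  - apply box_ext; intros x y; rewrite Ep, Eq; unfold opD; ring.
Qed.

(** [v (w v_x + (w v)_x) = (w v^2)_x] and [v v_x = (v^2 / 2)_x], so the
    integrand [v G(w) v] is minus the divergence of
    [(alpha, beta) (1/2 + w/3) v^2]. *)
Lemma inner_opG_diag xl xr yl yr alpha beta w v :
  yl < yr -> C1_periodic xl xr yl yr w -> C1_periodic xl xr yl yr v ->
  inner xl xr yl yr v (opG alpha beta w v) = 0.
Proof.
  intros Hy Cw Cv.
  pose proof (C1_periodic_const xl xr yl yr (/ 2)) as C2.
  pose proof (C1_periodic_const xl xr yl yr (/ 3)) as C3.
  pose proof (C1_periodic_mult _ _ _ _ _ _ C3 Cw) as C3w.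
  pose proof (C1_periodic_plus _ _ _ _ _ _ C2 C3w) as Ch.
  pose proof (C1_periodic_mult _ _ _ _ _ _ Cv Cv) as Cvv.
  pose proof (C1_periodic_mult _ _ _ _ _ _ Ch Cvv) as Cp.
  transitivity (box xl xr yl yr (fun _ _ => 0)).
  - etransitivity; [| refine (box_add_divergence _ _ _ _ _ _ _
      (- alpha) (- beta) Hy (C1_cont (C1_periodic_const xl xr yl yr 0)) Cp Cp)].
    apply box_ext; intros x y.
    rewrite (dx_mult _ _ _ _ _ _ _ _ Ch Cvv), (dx_plus _ _ _ _ _ _ _ _ C2 C3w),
      (dx_mult _ _ _ _ _ _ _ _ C3 Cw), (dx_mult _ _ _ _ _ _ _ _ Cv Cv).
    rewrite (dy_mult _ _ _ _ _ _ _ _ Ch Cvv), (dy_plus _ _ _ _ _ _ _ _ C2 C3w),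
      (dy_mult _ _ _ _ _ _ _ _ C3 Cw), (dy_mult _ _ _ _ _ _ _ _ Cv Cv).
    unfold opG.
    rewrite (dx_mult _ _ _ _ _ _ _ _ Cw Cv), (dy_mult _ _ _ _ _ _ _ _ Cw Cv).
    rewrite !dx_const, !dy_const.
    field.
  - apply box_0.
Qed.

Lemma C1_periodic_lagrange xl xr yl yr (data : list (R * field)) t :
  (forall d, In d data -> C1_periodic xl xr yl yr (snd d)) ->
  C1_periodic xl xr yl yr (lagrange data t).
Proof.
  unfold lagrange.
  (* The basis polynomials depend on the whole list of nodes, which must stay
     fixed while the sum is taken apart. *)
  generalize (map fst data) as ts.
  induction data as [| d l IH]; intros ts H.
  - apply (C1_periodic_const _ _ _ _ 0).
  - apply (C1_periodic_plus _ _ _ _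
             (fun x y => snd d x y * lagrange_basis ts (fst d) t)).
    + apply (C1_periodic_mult _ _ _ _ (snd d)); [apply H; now left |].
      apply C1_periodic_const.
    + apply IH; intros e He; apply H; now right.
Qed.

(** * Runge-Kutta algebra *)

Lemma stage_sum_ext s f g :
  (forall i, stage_index s i -> f i = g i) -> stage_sum s f = stage_sum s g.
Proof. intros H; now apply sum_n_m_ext_loc. Qed.

Lemma stage_sum_lin s f g (r : R) :
  stage_sum s (fun i => f i + r * g i) = stage_sum s f + r * stage_sum s g.
Proof.
  unfold stage_sum.
  rewrite (sum_n_m_plus (G := R_AbelianMonoid) f (fun i => r * g i)).
  now rewrite (sum_n_m_mult_l (K := R_Ring) r g).
Qed.

Lemma stage_sum_scal s f (r : R) :
  stage_sum s (fun i => r * f i) = r * stage_sum s f.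
Proof. apply (sum_n_m_mult_l (K := R_Ring)). Qed.

Lemma stage_sum_0 f : stage_sum 0 f = 0.
Proof. apply (sum_n_m_zero (G := R_AbelianMonoid)); lia. Qed.

Lemma stage_sum_S s f : stage_sum (S s) f = stage_sum s f + f (S s).
Proof. apply (sum_n_Sm (G := R_AbelianMonoid)); lia. Qed.

Lemma stage_sum_swap p q (F : nat -> nat -> R) :
  stage_sum p (fun i => stage_sum q (fun j => F i j))
  = stage_sum q (fun j => stage_sum p (fun i => F i j)).
Proof.
  induction p as [| p IH].
  - rewrite stage_sum_0; transitivity (stage_sum q (fun j => 0 * 0)).
    + rewrite stage_sum_scal; ring.
    + apply stage_sum_ext; intros; rewrite stage_sum_0; ring.
  - rewrite stage_sum_S, IH.
    rewrite <- (Rmult_1_l (stage_sum q (fun j => F (S p) j))).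
    rewrite <- stage_sum_lin; apply stage_sum_ext; intros j _.
    rewrite stage_sum_S; ring.
Qed.

(** With [g i = B(u, k_i)] and [m i j = B(k_i, k_j)], the left-hand side is
    the increment of [B(u, u)] over one step, divided by [tau].  Averaging the
    double sum of [b_i a_ij m_ij] with its transpose, which is legitimate as
    [m] is symmetric, brings out the condition on the coefficients. *)
Lemma symplectic_cancellation s (a m : nat -> nat -> R) (b g : nat -> R) tau :
  (forall i j, stage_index s i -> stage_index s j ->
     b i * a i j + b j * a j i = b i * b j) ->
  (forall i j, stage_index s i -> stage_index s j -> m i j = m j i) ->
  (forall i, stage_index s i ->
     g i + tau * stage_sum s (fun j => a i j * m j i) = 0) ->
  2 * stage_sum s (fun i => b i * g i)
  + tau * stage_sum s (fun i => b i * stage_sum s (fun j => b j * m j i)) = 0.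
Proof.
  intros Hsymp Hm Hg.
  set (A := stage_sum s (fun i => stage_sum s (fun j => b i * a i j * m j i))).
  assert (Eg : stage_sum s (fun i => b i * g i) = - tau * A).
  { unfold A; rewrite <- stage_sum_scal; apply stage_sum_ext; intros i Hi.
    replace (g i) with (- tau * stage_sum s (fun j => a i j * m j i))
      by (pose proof (Hg i Hi); lra).
    rewrite <- !stage_sum_scal; apply stage_sum_ext; intros j Hj; ring. }
  assert (Et : A = stage_sum s (fun i => stage_sum s (fun j => b j * a j i * m j i))).
  { unfold A; rewrite stage_sum_swap.
    apply stage_sum_ext; intros i Hi; apply stage_sum_ext; intros j Hj.
    now rewrite (Hm i j). }
  assert (Eb : stage_sum s (fun i => b i * stage_sum s (fun j => b j * m j i))
               = A + 1 * A).
  { rewrite Et at 2; unfold A; rewrite <- stage_sum_lin.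
    apply stage_sum_ext; intros i Hi.
    rewrite <- stage_sum_lin, <- stage_sum_scal; apply stage_sum_ext; intros j Hj.
    transitivity (b i * b j * m j i); [ring |].
    rewrite <- (Hsymp i j Hi Hj); ring. }
  rewrite Eg, Eb; ring.
Qed.

Lemma continuous_field_stage_sum s (w : nat -> R) (k : nat -> field) :
  (forall i, stage_index s i -> continuous_field (k i)) ->
  continuous_field (fun x y => stage_sum s (fun i => w i * k i x y)).
Proof.
  induction s as [| s IH]; intros Ck x y.
  - apply continuity_2d_pt_ext with (fun _ _ => 0).
    + intros; now rewrite stage_sum_0.
    + apply continuity_2d_pt_const.
  - apply continuity_2d_pt_ext
      with (fun x y => stage_sum s (fun i => w i * k i x y) + w (S s) * k (S s) x y).
    + intros; now rewrite stage_sum_S.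
    + apply continuity_2d_pt_plus.
      * apply IH; intros i Hi; apply Ck; unfold stage_index in *; lia.
      * apply continuity_2d_pt_mult; [apply continuity_2d_pt_const |].
        apply Ck; unfold stage_index; lia.
Qed.

Lemma inner_lin xl xr yl yr f h g (r : R) :
  yl < yr -> continuous_field f -> continuous_field h -> continuous_field g ->
  inner xl xr yl yr (fun x y => f x y + r * h x y) g
  = inner xl xr yl yr f g + r * inner xl xr yl yr h g.
Proof.
  intros Hy Cf Ch Cg.
  etransitivity; [| apply (box_lin xl xr yl yr (fun x y => f x y * g x y)
                             (fun x y => h x y * g x y) r Hy)].
  - apply box_ext; intros x y; ring.
  - intros x y; apply continuity_2d_pt_mult; [exact (Cf x y) | exact (Cg x y)].
  - intros x y; apply continuity_2d_pt_mult; [exact (Ch x y) | exact (Cg x y)].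
Qed.

Lemma inner_stage_sum xl xr yl yr s (w : nat -> R) (k : nat -> field) g :
  yl < yr -> (forall i, stage_index s i -> continuous_field (k i)) ->
  continuous_field g ->
  inner xl xr yl yr (fun x y => stage_sum s (fun i => w i * k i x y)) g
  = stage_sum s (fun i => w i * inner xl xr yl yr (k i) g).
Proof.
  intros Hy; induction s as [| s IH]; intros Ck Cg.
  - rewrite stage_sum_0.
    etransitivity; [| apply (box_0 xl xr yl yr)].
    apply box_ext; intros x y; rewrite stage_sum_0; ring.
  - assert (Ck' : forall i, stage_index s i -> continuous_field (k i)).
    { intros i Hi; apply Ck; unfold stage_index in *; lia. }
    rewrite stage_sum_S, <- (IH Ck' Cg), <- inner_lin; trivial.
    + apply box_ext; intros x y; now rewrite stage_sum_S.
    + now apply continuous_field_stage_sum.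
    + apply Ck; unfold stage_index; lia.
Qed.

(** The form in which the stage and step equations enter [B]. *)
Lemma inner_update xl xr yl yr s (w : nat -> R) (k : nat -> field) f f' g tau :
  yl < yr -> continuous_field f ->
  (forall i, stage_index s i -> continuous_field (k i)) -> continuous_field g ->
  (forall x y, f' x y = f x y + tau * stage_sum s (fun i => w i * k i x y)) ->
  inner xl xr yl yr f' g
  = inner xl xr yl yr f g
    + tau * stage_sum s (fun i => w i * inner xl xr yl yr (k i) g).
Proof.
  intros Hy Cf Ck Cg E.
  rewrite <- inner_stage_sum, <- inner_lin; trivial.
  - apply box_ext; intros x y; now rewrite E.
  - now apply continuous_field_stage_sum.
Qed.

(** * Conservation of momentum *)

Theorem theorem2p1
  (xl xr yl yr alpha beta mu theta tau : R)
  (Hx : xl < xr) (Hy : yl < yr)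
  (Hmu : 0 < mu) (Htheta : 0 < theta) (Htau : 0 < tau)
  (s : nat) (Hs : (1 <= s)%nat)
  (a : nat -> nat -> R) (b c : nat -> R)
  (Hc : forall i, stage_index s i -> c i = stage_sum s (fun j => a i j))
  (Hc_distinct : forall i j, stage_index s i -> stage_index s j -> i <> j -> c i <> c j)
  (Hsymp : forall i j, stage_index s i -> stage_index s j ->
     b i * a i j + b j * a j i = b i * b j)
  (nodes : nat -> list node)
  (u : nat -> field) (U k : nat -> nat -> field)
  (Hscheme : scheme xl xr yl yr alpha beta mu theta tau s a b c nodes u U k) :
  forall n : nat,
    momentum xl xr yl yr mu theta (u (S n)) = momentum xl xr yl yr mu theta (u n).
Proof.
  destruct Hscheme as [Su SU Hnodes Hslope Hstage Hstep]; intros n.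
  assert (Sk : forall i, stage_index s i -> smooth_periodic xl xr yl yr (k n i))
    by (intros i Hi; apply (Hslope n i Hi)).
  assert (Cs : forall f, smooth_periodic xl xr yl yr f -> continuous_field f)
    by (intros f Sf; apply (C1_cont (smooth_periodic_C1 _ _ _ _ _ Sf))).
  assert (Ck : forall i, stage_index s i -> continuous_field (k n i))
    by (intros i Hi; now apply Cs, Sk).
  set (B := fun f g => inner xl xr yl yr f (opD mu theta g)).
  assert (Bsym : forall f g, smooth_periodic xl xr yl yr f ->
            smooth_periodic xl xr yl yr g -> B f g = B g f)
    by (intros f g Sf Sg; exact (inner_opD_sym _ _ _ _ mu theta f g Hy Sf Sg)).
  assert (Bstep : forall g, smooth_periodic xl xr yl yr g ->
            B (u (S n)) g = B (u n) g + tau * stage_sum s (fun i => b i * B (k n i) g)).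
  { intros g Sg.
    exact (inner_update _ _ _ _ s b (k n) (u n) (u (S n)) (opD mu theta g) tau Hy
             (Cs _ (Su n)) Ck (continuous_opD _ _ _ _ mu theta g Sg) (Hstep n)). }
  assert (Bstage : forall i, stage_index s i ->
            B (u n) (k n i) + tau * stage_sum s (fun j => a i j * B (k n j) (k n i)) = 0).
  { intros i Hi; transitivity (B (U n i) (k n i)).
    - symmetry.
      exact (inner_update _ _ _ _ s (a i) (k n) (u n) (U n i)
               (opD mu theta (k n i)) tau Hy (Cs _ (Su n)) Ck
               (continuous_opD _ _ _ _ mu theta _ (Sk i Hi)) (Hstage n i Hi)).
    - set (w := L_MP tau c u U (nodes n) (INR n * tau + c i * tau)).
      transitivity (inner xl xr yl yr (U n i) (opG alpha beta w (U n i))).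
      + apply (box_ext _ _ _ _
          (fun x y => U n i x y * opD mu theta (k n i) x y)
          (fun x y => U n i x y * opG alpha beta w (U n i) x y)); intros x y.
        exact (f_equal (Rmult (U n i x y)) (proj2 (Hslope n i Hi) x y)).
      + apply inner_opG_diag;
          [exact Hy | | exact (smooth_periodic_C1 _ _ _ _ _ (SU n i Hi))].
        apply C1_periodic_lagrange; intros d Hd.
        apply in_map_iff in Hd; destruct Hd as (p & <- & Hp).
        apply smooth_periodic_C1.
        destruct (Hnodes n) as (_ & _ & Hcomp).
        destruct p as [m | m i']; simpl; [apply Su |].
        apply SU, (Hcomp _ Hp). }
  pose proof (symplectic_cancellation s a (fun i j => B (k n i) (k n j)) b
    (fun i => B (u n) (k n i)) tau Hsymp
    (fun i j Hi Hj => Bsym _ _ (Sk i Hi) (Sk j Hj)) Bstage) as H0.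
  unfold momentum; f_equal; change (B (u (S n)) (u (S n)) = B (u n) (u n)).
  (* Symmetry lets the increment of [B (u (S n)) (u (S n))] be expanded in one
     argument at a time, with the update always on the left. *)
  rewrite (Bstep _ (Su (S n))), (Bsym _ _ (Su n) (Su (S n))), (Bstep _ (Su n)).
  rewrite (stage_sum_ext s (fun i => b i * B (k n i) (u n))
             (fun i => b i * B (u n) (k n i)))
    by (intros i Hi; now rewrite (Bsym _ _ (Sk i Hi) (Su n))).
  rewrite (stage_sum_ext s (fun i => b i * B (k n i) (u (S n)))
             (fun i => b i * B (u n) (k n i)
                + tau * (b i * stage_sum s (fun j => b j * B (k n j) (k n i))))).
  - rewrite stage_sum_lin.
    apply Rminus_diag_uniq; rewrite <- (Rmult_0_r tau), <- H0; ring.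
  - intros i Hi; rewrite (Bsym _ _ (Sk i Hi) (Su (S n))), (Bstep _ (Sk i Hi)); ring.
Qed.
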